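(* For the general Fighter problem, i.e. for every $0\le u\le 1$, property [C] holds: for every fixed $t\ge 0$, the quantity $n-K(n,t)$ is non-decreasing in $n$, $n=1,2,\dots$.
   Context: Fighter problem with discrete ammunition. Fix $u\in[0,1]$ and a sequence of probabilities $0=a(0)<a(1)<a(2)<\cdots$ (each $a(j)\in[0,1]$) that is strictly increasing and concave, i.e. $a(j+2)-a(j+1)\le a(j+1)-a(j)$ for all $j\ge 0$. Here $a(j)$ is the probability that an enemy plane is shot down when $j$ missiles are spent on it; if it is not shot down, the fighter survives with probability $u$; enemies arrive according to a Poisson process of rate $1$. Put $c(j)=a(j)+u(1-a(j))$. For $t\ge 0$ (remaining flying time) define inductively on $n$: $N(0,t)=0$; for $r\ge 0$, $N^*(r,t)=e^{-t}\int_0^t N(r,x)e^x\,dx$ (so $N^*(0,t)=0$); for $n\ge 1$ and $1\le j\le n$, $N_n(j,t)=a(j)+c(j)N^*(n-j,t)$; and $N(n,t)=\max_{1\le j\le n}N_n(j,t)$. Thus $N_n(j,t)$ is the expected number of enemies shot down when confronting an enemy with $n$ missiles and time $t$ remaining, spending $j$ missiles now and continuing optimally. The optimal spending policy (smallest optimal number of missiles) is, for $n\ge1$, $K(n,t)=\min\{j\in\{1,\dots,n\}: N_n(j,t)=\max_{1\le i\le n}N_n(i,t)\}$. *)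

(* Defs.v *)
From Stdlib Require Import Reals Lra Lia List.
From Coquelicot Require Import Coquelicot.
Open Scope R_scope.

(* max_{1 <= j <= n} f j, for n >= 1; the value 0 at n = 0 is a junk value. *)
Fixpoint max1 (f : nat -> R) (n : nat) : R :=
  match n with
  | O => 0
  | S O => f 1%nat
  | S m => Rmax (max1 f m) (f n)
  end.

Lemma max1_ge (f : nat -> R) (n j : nat) :
  (1 <= j <= n)%nat -> f j <= max1 f n.
Proof.
  induction n as [|[|n] IH]; intros Hj; [lia| |].
  - replace j with 1%nat by lia. simpl. lra.
  - change (f j <= Rmax (max1 f (S n)) (f (S (S n)))).
    destruct (Nat.eq_dec j (S (S n))) as [->|Hne]; [apply Rmax_r|].
    eapply Rle_trans; [apply IH; lia|apply Rmax_l].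
Qed.

Lemma max1_attained (f : nat -> R) (n : nat) :
  (1 <= n)%nat -> exists j : nat, (1 <= j <= n)%nat /\ f j = max1 f n.
Proof.
  induction n as [|[|n] IH]; intros Hn; [lia| |].
  - exists 1%nat; split; [lia|reflexivity].
  - change (exists j : nat, (1 <= j <= S (S n))%nat /\
              f j = Rmax (max1 f (S n)) (f (S (S n)))).
    destruct IH as [j [Hj Ej]]; [lia|].
    destruct (Rle_dec (max1 f (S n)) (f (S (S n)))) as [H|H].
    + exists (S (S n)); split; [lia|]. now rewrite Rmax_right.
    + exists j; split; [lia|]. rewrite Rmax_left; lra.
Qed.

Lemma max1_ext (f g : nat -> R) (n : nat) :
  (forall j : nat, (1 <= j <= n)%nat -> f j = g j) -> max1 f n = max1 g n.
Proof.
  induction n as [|[|n] IH]; intros H; [reflexivity|apply H; lia|].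
  change (Rmax (max1 f (S n)) (f (S (S n))) = Rmax (max1 g (S n)) (g (S (S n)))).
  rewrite IH; [|intros; apply H; lia]. now rewrite H by lia.
Qed.

Definition cprob (a : nat -> R) (u : R) (j : nat) : R := a j + u * (1 - a j).

(* N*(r,t) = e^{-t} int_0^t N(r,x) e^x dx, with M in the role of N. The functions
   N(r,.) below are continuous, so the Riemann integral RInt is a genuine one. *)
Definition star (M : nat -> R -> R) (r : nat) (t : R) : R :=
  exp (- t) * RInt (fun x => M r x * exp x) 0 t.

Definition stage (a : nat -> R) (u : R) (M : nat -> R -> R)
    (n j : nat) (t : R) : R :=
  a j + cprob a u j * star M (n - j) t.

(* Nval a u n t is N(n,t), defined by course-of-values recursion: N_upto a u m r
   is N(r,.) as soon as r <= m.  See Nval_0 and Nval_rec for the recursion it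
   satisfies. *)
Fixpoint N_upto (a : nat -> R) (u : R) (m : nat) : nat -> R -> R :=
  match m with
  | O => fun _ _ => 0
  | S m' => fun r t => max1 (fun j => stage a u (N_upto a u m') r j t) r
  end.

Definition Nval (a : nat -> R) (u : R) (n : nat) (t : R) : R := N_upto a u n n t.

Definition Nstar (a : nat -> R) (u : R) : nat -> R -> R := star (Nval a u).

(* Nmiss a u n j t is N_n(j,t); meaningful for 1 <= j <= n. *)
Definition Nmiss (a : nat -> R) (u : R) (n j : nat) (t : R) : R :=
  a j + cprob a u j * Nstar a u (n - j) t.

Lemma star_ext (M M' : nat -> R -> R) (r : nat) (t : R) :
  (forall x : R, M r x = M' r x) -> star M r t = star M' r t.
Proof.
  intros H. unfold star. f_equal. apply RInt_ext. intros x _. now rewrite H.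
Qed.

Lemma N_upto_Nval (a : nat -> R) (u : R) (m r : nat) (t : R) :
  (r <= m)%nat -> N_upto a u m r t = Nval a u r t.
Proof.
  assert (G : forall m m' r t, (r <= m)%nat -> (r <= m')%nat ->
                N_upto a u m r t = N_upto a u m' r t).
  { clear. induction m as [|m IH]; intros [|m'] r t H H'; try reflexivity.
    - now replace r with 0%nat by lia.
    - now replace r with 0%nat by lia.
    - simpl. apply max1_ext. intros j Hj. unfold stage. f_equal. f_equal.
      apply star_ext. intros x. apply IH; lia. }
  intros H. apply G; lia.
Qed.

Lemma Nval_0 (a : nat -> R) (u t : R) : Nval a u 0 t = 0.
Proof. reflexivity. Qed.

Lemma Nval_rec (a : nat -> R) (u : R) (n : nat) (t : R) :
  (1 <= n)%nat -> Nval a u n t = max1 (fun j => Nmiss a u n j t) n.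
Proof.
  destruct n as [|n]; intros Hn; [lia|].
  change (max1 (fun j => stage a u (N_upto a u n) (S n) j t) (S n) =
          max1 (fun j => Nmiss a u (S n) j t) (S n)).
  apply max1_ext. intros j Hj. unfold stage, Nmiss, Nstar. f_equal. f_equal.
  apply star_ext. intros x. apply N_upto_Nval. lia.
Qed.

(* The default value 0 is never used when n >= 1, see K_spec. *)
Definition K (a : nat -> R) (u : R) (n : nat) (t : R) : nat :=
  match find (fun j => if Req_dec_T (Nmiss a u n j t)
                                    (max1 (fun i => Nmiss a u n i t) n)
                       then true else false) (seq 1 n) with
  | Some j => j
  | None => 0%nat
  end.

Lemma find_seq_min (p : nat -> bool) (s n : nat) :
  match find p (seq s n) with
  | Some k => (s <= k < s + n)%nat /\ p k = true /\
              forall j : nat, (s <= j < k)%nat -> p j = false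
  | None => forall j : nat, (s <= j < s + n)%nat -> p j = false
  end.
Proof.
  revert s; induction n as [|n IH]; intros s; simpl; [intros; lia|].
  destruct (p s) eqn:E.
  - split; [lia|]. split; [exact E|intros; lia].
  - specialize (IH (S s)). destruct (find p (seq (S s) n)) as [k|].
    + destruct IH as [H1 [H2 H3]]. split; [lia|]. split; [exact H2|].
      intros j Hj. destruct (Nat.eq_dec j s) as [->|]; [exact E|apply H3; lia].
    + intros j Hj. destruct (Nat.eq_dec j s) as [->|]; [exact E|apply IH; lia].
Qed.

Lemma K_spec (a : nat -> R) (u : R) (n : nat) (t : R) :
  (1 <= n)%nat ->
  (1 <= K a u n t <= n)%nat /\
  Nmiss a u n (K a u n t) t = max1 (fun i => Nmiss a u n i t) n /\
  forall j : nat, (1 <= j < K a u n t)%nat ->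
    Nmiss a u n j t <> max1 (fun i => Nmiss a u n i t) n.
Proof.
  intros Hn. unfold K.
  match goal with |- context [find ?q _] => set (p := q) end.
  assert (Hp : forall j, p j = true <->
                 Nmiss a u n j t = max1 (fun i => Nmiss a u n i t) n).
  { intros j. unfold p. destruct Req_dec_T; split; congruence. }
  generalize (find_seq_min p 1 n).
  destruct (find p (seq 1 n)) as [k|]; intros H.
  - destruct H as [H1 [H2 H3]]. split; [lia|]. split; [now apply Hp|].
    intros j Hj E. apply Hp in E. rewrite H3 in E by exact Hj. discriminate.
  - destruct (max1_attained (fun i => Nmiss a u n i t) n Hn) as [j [Hj Ej]].
    apply Hp in Ej. rewrite H in Ej by lia. discriminate.
Qed.

(* Main.v *)
(* Writing r = n - j for the ammunition kept back, the payoff is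
   a (n - r) * (1 + (1 - u) * N*(r,t)) + u * N*(r,t).  Its increment in n,
   (a (n + 1 - r) - a (n - r)) * (1 + (1 - u) * N*(r,t)), is a product of two
   nonnegative factors that are both non-decreasing in r: the first because a is
   concave, the second because N* increases with the ammunition.  So the payoff
   has increasing differences in (n, r), and its largest maximiser n - K(n,t) is
   non-decreasing in n (Topkis). *)

Require Import Defs.
From Stdlib Require Import Reals Lra Lia Wf_nat.
From Coquelicot Require Import Coquelicot.
Open Scope R_scope.

Lemma continuous_Rmax (f g : R -> R) (x : R) :
  continuous f x -> continuous g x -> continuous (fun y => Rmax (f y) (g y)) x.
Proof.
  intros Hf Hg.
  apply continuous_ext with (fun y => / 2 * (f y + g y + Rabs (f y - g y))).
  { intros y. destruct (Rle_dec (f y) (g y)).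
    - rewrite Rmax_right, Rabs_left1 by lra. simpl. lra.
    - rewrite Rmax_left, Rabs_right by lra. simpl. lra. }
  apply (continuous_scal_r (/ 2) (fun y => f y + g y + Rabs (f y - g y))).
  apply (continuous_plus (fun y => f y + g y) (fun y => Rabs (f y - g y))).
  - now apply (continuous_plus f g).
  - apply (continuous_comp (fun y => f y - g y) Rabs).
    + now apply (continuous_minus f g).
    + apply continuous_Rabs.
Qed.

Lemma continuous_max1 (f : nat -> R -> R) (n : nat) (x : R) :
  (forall j : nat, (1 <= j <= n)%nat -> continuous (f j) x) ->
  continuous (fun y => max1 (fun j => f j y) n) x.
Proof.
  induction n as [|[|n] IH]; intros H.
  - apply continuous_const.
  - apply (H 1%nat). lia.
  - apply (continuous_Rmax (fun y => max1 (fun j => f j y) (S n)) (f (S (S n)))).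
    + apply IH. intros j Hj. apply H. lia.
    + apply H. lia.
Qed.

Lemma continuous_mult_exp (f : R -> R) (x : R) :
  continuous f x -> continuous (fun y => f y * exp y) x.
Proof.
  intros Hf. apply (continuous_mult f exp); [exact Hf|].
  apply (ex_derive_continuous exp). auto_derive. trivial.
Qed.

Lemma ex_RInt_mult_exp (f : R -> R) (s t : R) :
  (forall x : R, continuous f x) -> ex_RInt (fun x => f x * exp x) s t.
Proof.
  intros Hf. apply (ex_RInt_continuous (V := R_CompleteNormedModule)).
  intros x _. now apply continuous_mult_exp.
Qed.

(** By the fundamental theorem of calculus the integral is differentiable in its upper limit, hence
    continuous. *)
Lemma continuous_star (M : nat -> R -> R) (r : nat) (t : R) :
  (forall x : R, continuous (M r) x) -> continuous (star M r) t.
Proof.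
  intros HM.
  apply (continuous_mult (fun t => exp (- t))
           (fun t => RInt (fun x => M r x * exp x) 0 t)).
  - apply (ex_derive_continuous (fun t => exp (- t))). auto_derive. trivial.
  - apply (ex_derive_continuous (fun t => RInt (fun x => M r x * exp x) 0 t)).
    exists (M r t * exp t).
    apply (is_derive_RInt (fun x => M r x * exp x) _ 0).
    + apply filter_forall. intros x.
      apply (RInt_correct (V := R_CompleteNormedModule)).
      now apply ex_RInt_mult_exp.
    + now apply continuous_mult_exp.
Qed.

(** Supplies the integrability that comparing two values of [RInt] requires. The induction is strong
    because the payoffs with [n] missiles involve every smaller reserve. *)
Lemma continuous_Nval (a : nat -> R) (u : R) (n : nat) (t : R) :
  continuous (Nval a u n) t.
Proof.
  revert t. induction n as [[|n] IH] using (well_founded_induction lt_wf); intros t.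
  - apply continuous_const.
  - apply continuous_ext with (fun x => max1 (fun j => Nmiss a u (S n) j x) (S n)).
    { intros x. symmetry. apply Nval_rec. lia. }
    apply continuous_max1. intros j Hj.
    apply (continuous_plus (fun _ => a j)
             (fun x => cprob a u j * Nstar a u (S n - j) x)).
    + apply continuous_const.
    + apply (continuous_scal_r (cprob a u j) (Nstar a u (S n - j))).
      apply continuous_star. intros x. apply IH. lia.
Qed.

(** Only times between 0 and [t] enter the integral, so comparing the values at nonnegative times
    suffices. *)
Lemma Nstar_le (a : nat -> R) (u : R) (r s : nat) (t : R) :
  0 <= t -> (forall x : R, 0 <= x -> Nval a u r x <= Nval a u s x) ->
  Nstar a u r t <= Nstar a u s t.
Proof.
  intros Ht H. unfold Nstar, star.
  apply Rmult_le_compat_l; [left; apply exp_pos|].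
  apply RInt_le; [exact Ht|apply ex_RInt_mult_exp, continuous_Nval..|].
  intros x Hx. apply Rmult_le_compat_r; [left; apply exp_pos|]. apply H. lra.
Qed.

Lemma Nstar_0 (a : nat -> R) (u t : R) : Nstar a u 0 t = 0.
Proof.
  unfold Nstar, star.
  rewrite (RInt_ext _ (fun _ => 0)).
  - rewrite RInt_const. unfold scal. simpl. unfold mult. simpl. ring.
  - intros x _. rewrite Nval_0. apply Rmult_0_l.
Qed.

Lemma cprob_ge0 (a : nat -> R) (u : R) (j : nat) :
  0 <= u -> 0 <= a j <= 1 -> 0 <= cprob a u j.
Proof. intros Hu Ha. unfold cprob. nra. Qed.

(** The maximum is at least the payoff of firing a single missile, which is built from nonnegative
    terms. *)
Lemma Nval_ge0 (a : nat -> R) (u : R) (n : nat) (t : R) :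
  0 <= u -> (forall j : nat, 0 <= a j <= 1) -> 0 <= t -> 0 <= Nval a u n t.
Proof.
  intros Hu Ha. revert t.
  induction n as [[|n] IH] using (well_founded_induction lt_wf); intros t Ht.
  - rewrite Nval_0. lra.
  - rewrite Nval_rec by lia.
    apply Rle_trans with (Nmiss a u (S n) 1 t);
      [|apply (max1_ge (fun j => Nmiss a u (S n) j t)); lia].
    assert (H : 0 <= Nstar a u (S n - 1) t).
    (* With 0 written as [Nstar a u 0 t], nonnegativity becomes a comparison of two ammunition
       levels, settled by the induction hypothesis. *)
    { rewrite <- (Nstar_0 a u t). apply Nstar_le; [exact Ht|].
      intros x Hx. rewrite Nval_0. apply IH; [lia|exact Hx]. }
    assert (Hc := cprob_ge0 a u 1 Hu (Ha 1%nat)).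
    specialize (Ha 1%nat). unfold Nmiss. nra.
Qed.

Lemma Nstar_ge0 (a : nat -> R) (u : R) (n : nat) (t : R) :
  0 <= u -> (forall j : nat, 0 <= a j <= 1) -> 0 <= t -> 0 <= Nstar a u n t.
Proof.
  intros Hu Ha Ht. rewrite <- (Nstar_0 a u t). apply Nstar_le; [exact Ht|].
  intros x Hx. rewrite Nval_0. now apply Nval_ge0.
Qed.

(* The extra missile is fired at once, together with an optimal salvo. *)
Lemma Nval_leS (a : nat -> R) (u : R) (n : nat) (t : R) :
  0 <= u <= 1 -> (forall j : nat, 0 <= a j <= 1) ->
  (forall j : nat, a j <= a (S j)) -> 0 <= t ->
  Nval a u n t <= Nval a u (S n) t.
Proof.
  intros Hu Ha Hincr Ht. destruct n as [|n].
  { rewrite Nval_0. apply Nval_ge0; [lra|exact Ha|exact Ht]. }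
  rewrite !Nval_rec by lia.
  destruct (max1_attained (fun j => Nmiss a u (S n) j t) (S n)) as [j [Hj <-]];
    [lia|].
  apply Rle_trans with (Nmiss a u (S (S n)) (S j) t);
    [|apply (max1_ge (fun j => Nmiss a u (S (S n)) j t)); lia].
  unfold Nmiss. replace (S (S n) - S j)%nat with (S n - j)%nat by lia.
  assert (HN : 0 <= Nstar a u (S n - j) t) by (apply Nstar_ge0; tauto).
  specialize (Hincr j).
  (* [cprob a u j = u + (1 - u) * a j] grows with [a j] because [u <= 1]. *)
  assert (cprob a u j <= cprob a u (S j)) by (unfold cprob; nra).
  nra.
Qed.

Lemma Nstar_mono (a : nat -> R) (u : R) (r s : nat) (t : R) :
  0 <= u <= 1 -> (forall j : nat, 0 <= a j <= 1) ->
  (forall j : nat, a j <= a (S j)) -> 0 <= t -> (r <= s)%nat ->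
  Nstar a u r t <= Nstar a u s t.
Proof.
  intros Hu Ha Hincr Ht Hrs.
  induction Hrs as [|s _ IH]; [apply Rle_refl|].
  eapply Rle_trans; [exact IH|]. apply Nstar_le; [exact Ht|].
  intros x Hx. now apply Nval_leS.
Qed.

Lemma concave_increment_antitone (a : nat -> R) (i j : nat) :
  (forall k : nat, a (S (S k)) - a (S k) <= a (S k) - a k) -> (i <= j)%nat ->
  a (S j) - a j <= a (S i) - a i.
Proof.
  intros Hc Hij. induction Hij as [|j _ IH]; [apply Rle_refl|].
  eapply Rle_trans; [apply Hc|exact IH].
Qed.

(** Passing from [(n, j)] to [(S n, S j)] keeps the reserve [n - j] fixed. The order is reversed
    here because a larger salvo [j] means a smaller reserve. *)
Lemma Nmiss_increasing_differences (a : nat -> R) (u : R) (n i j : nat) (t : R) :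
  0 <= u <= 1 -> (forall k : nat, 0 <= a k <= 1) ->
  (forall k : nat, a k <= a (S k)) ->
  (forall k : nat, a (S (S k)) - a (S k) <= a (S k) - a k) ->
  0 <= t -> (i <= j <= n)%nat ->
  Nmiss a u (S n) (S j) t - Nmiss a u n j t <=
  Nmiss a u (S n) (S i) t - Nmiss a u n i t.
Proof.
  intros Hu Ha Hincr Hconc Ht Hij. unfold Nmiss, cprob.
  rewrite !Nat.sub_succ.
  assert (Hd := concave_increment_antitone a i j Hconc ltac:(lia)).
  assert (Hd0 := Hincr j).
  assert (HN : Nstar a u (n - j) t <= Nstar a u (n - i) t)
    by (apply Nstar_mono; (assumption || lia)).
  assert (HN0 : 0 <= Nstar a u (n - j) t) by (apply Nstar_ge0; tauto).
  set (x := Nstar a u (n - j) t) in *. set (y := Nstar a u (n - i) t) in *.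
  (* Once expanded, these products are the two sides of the goal, the terms [u * x] and [u * y]
     having cancelled. *)
  assert (H : (a (S j) - a j) * (1 + (1 - u) * x) <=
              (a (S i) - a i) * (1 + (1 - u) * y)).
  { apply Rmult_le_compat; [lra|nra|lra|nra]. }
  lra.
Qed.

(** Let [k] and [l] be the policies at [n] and [S n]. If [l > S k], the gain of [l] over [S k] at
    [S n] is at most that of [l - 1] over [k] at [n], which is not positive. So [S k] is optimal
    too, against the minimality of [l]. *)
Lemma K_succ_le (a : nat -> R) (u : R) (n : nat) (t : R) :
  0 <= u <= 1 -> (forall k : nat, 0 <= a k <= 1) ->
  (forall k : nat, a k <= a (S k)) ->
  (forall k : nat, a (S (S k)) - a (S k) <= a (S k) - a k) ->
  0 <= t -> (1 <= n)%nat ->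
  (K a u (S n) t <= S (K a u n t))%nat.
Proof.
  intros Hu Ha Hincr Hconc Ht Hn.
  destruct (K_spec a u n t Hn) as [Hk [Ek _]].
  destruct (K_spec a u (S n) t) as [Hl [El Hmin]]; [lia|].
  set (k := K a u n t) in *. set (l := K a u (S n) t) in *.
  destruct (Nat.le_gt_cases l (S k)) as [|Hlt]; [assumption|exfalso].
  apply (Hmin (S k)); [lia|].
  (* The salvo [l - 1] is admissible at [n], since [S k < l <= S n]. *)
  assert (Hd := Nmiss_increasing_differences a u n k (l - 1) t
                  Hu Ha Hincr Hconc Ht ltac:(lia)).
  replace (S (l - 1)) with l in Hd by lia.
  assert (H1 := max1_ge (fun i => Nmiss a u n i t) n (l - 1) ltac:(lia)).
  assert (H2 := max1_ge (fun i => Nmiss a u (S n) i t) (S n) (S k) ltac:(lia)).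
  cbv beta in H1, H2. lra.
Qed.

Theorem theorem3p1 (a : nat -> R) (u : R)
    (hu : 0 <= u <= 1)
    (ha_prob : forall j : nat, 0 <= a j <= 1)
    (ha_zero : a 0%nat = 0)
    (ha_incr : forall j : nat, a j < a (S j))
    (ha_conc : forall j : nat,
       a (S (S j)) - a (S j) <= a (S j) - a j)
    (t : R) (ht : 0 <= t)
    (n m : nat) (hn : (1 <= n)%nat) (hnm : (n <= m)%nat) :
  (n - K a u n t <= m - K a u m t)%nat.
Proof.
  induction hnm as [|m hnm IH]; [lia|].
  (* Truncated subtraction is antitone in its second argument and [S m - S k = m - k], so this bound
     carries the induction. *)
  assert (K a u (S m) t <= S (K a u m t))%nat; [|lia].
  apply K_succ_le; try assumption; [|lia].
  intros k. left. apply ha_incr.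
Qed.
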